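(* Let $k,n,r$ be positive integers with $2\le k\le r$. Then \[ \mathrm{ex}_r^{multi}(n,\mathcal{BC}_{\geq k})=\left\lfloor\frac{n-1}{r-1}\right\rfloor(k-1). \] Moreover, if $(r-1)\mid(n-1)$, then the only extremal $n$-vertex multi-$r$-graphs are the $(r,k-1)$-block trees.
   Context: A multi-$r$-graph is an $r$-uniform hypergraph in which hyperedges may be repeated (copies are distinct hyperedges). A Berge cycle of length $t$ is an alternating sequence $v_0,e_1,v_1,\dots,v_{t-1},e_t,v_0$ of distinct vertices and distinct hyperedges with $v_{i-1},v_i\in e_i$ (indices mod $t$); $\mathcal{BC}_{\geq k}$ is the family of Berge cycles of length at least $k$. $\mathrm{ex}_r^{multi}(n,\mathcal F)$ is the maximum number of hyperedges of an $n$-vertex multi-$r$-graph containing no member of $\mathcal F$. The 2-shadow $\partial_2\mathcal H$ is the graph on $V(\mathcal H)$ whose edges are pairs of vertices contained in a common hyperedge. A (multi-)$r$-graph $\mathcal H$ is an $(r,k-1)$-block tree if $\partial_2\mathcal H$ is connected and every 2-connected block of $\partial_2\mathcal H$ consists of $r$ vertices which induce exactly $k-1$ hyperedges of $\mathcal H$ (counted with multiplicity). *)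

(* Defs.v *)
From mathcomp Require Import all_boot.

Set Implicit Arguments.
Unset Strict Implicit.
Unset Printing Implicit Defensive.

(* Hyperedges are abstract elements carrying a vertex set, so that several
   distinct hyperedges (copies) may have the same vertex set. *)
Record multigraph (r : nat) := Multigraph {
  vertices : finType;
  hyperedges : finType;
  verts_of : hyperedges -> {set vertices};
  card_verts_of : forall e, #|verts_of e| = r
}.

Section MultiGraph.
Variable r : nat.
Implicit Types (H : multigraph r) (n t k m : nat).

(* Hyperedges are indexed from 0: hyperedge [e i] contains the cyclically
   consecutive vertices [v i] and [v (ordS i)], where [ordS i] is i + 1 mod t.
   Only lengths t >= 2 are meaningful. *)
Definition has_berge_cycle t H : Prop :=
  exists (v : 'I_t -> vertices H) (e : 'I_t -> hyperedges H),
    [/\ injective v, injective e &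
        forall i, v i \in verts_of (e i) /\ v (ordS i) \in verts_of (e i)].

Definition contains_BC_geq k H : Prop :=
  exists2 t, k <= t & has_berge_cycle t H.

(* [contains H] reads: H contains a member of the forbidden family. *)
Definition extremal n (contains : multigraph r -> Prop) H : Prop :=
  [/\ #|vertices H| = n, ~ contains H &
      forall H', #|vertices H'| = n -> ~ contains H' ->
        #|hyperedges H'| <= #|hyperedges H|].

(* A relation rather than a function, because for some forbidden families the
   number of repeated hyperedges is unbounded and no maximum exists. *)
Definition is_ex_multi n (contains : multigraph r -> Prop) m : Prop :=
  exists2 H, extremal n contains H & #|hyperedges H| = m.

Definition shadow H : rel (vertices H) :=
  fun x y => (x != y) && [exists e, (x \in verts_of e) && (y \in verts_of e)].

End MultiGraph.

Section Blocks.
Variables (T : finType) (adj : rel T).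
Implicit Types S B : {set T}.

Definition connected_on S : bool :=
  (S != set0) &&
  [forall x in S, forall y in S,
     connect [rel u w | [&& u \in S, w \in S & adj u w]] x y].

(* The subgraph induced by S is connected, has no cut vertex, and is not a
   single vertex.  As usual for blocks, a single edge is allowed. *)
Definition nonseparable S : bool :=
  [&& 1 < #|S|, connected_on S & [forall x in S, connected_on (S :\ x)]].

(* Blocks are induced subgraphs, hence are identified with vertex sets. *)
Definition is_block B : bool := maxset nonseparable B.

End Blocks.

(* An (r, m)-block tree. *)
Definition block_tree (r m : nat) (H : multigraph r) : Prop :=
  connected_on (@shadow r H) [set: vertices H] /\
  forall B : {set vertices H}, is_block (@shadow r H) B ->
    #|B| = r /\ #|[set e : hyperedges H | verts_of e \subset B]| = m.

(* Main.v *)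
Require Import Defs.
From mathcomp Require Import all_boot.
From mathcomp Require Import zify.

(* A Berge cycle of length t is a cycle of length 2t in the bipartite incidence
   graph of vertices and hyperedges.

   Key fact: if there is a hyperedge and no Berge cycle of length at least k,
   some r - 1 vertices are together incident with at most k - 1 hyperedges.
   Take a longest path v_0 e_1 v_1 e_2 ... of the incidence graph. Its start v_0
   lies only in hyperedges among e_1, ..., e_(k-1), since any other hyperedge
   through v_0 extends the path or closes a long cycle. Rotations that permute
   e_1, ..., e_(k-1) among themselves and keep the rest of the path produce more
   possible starts, one for each vertex u of e_1 other than v_1:
   - if u is off the path, u itself can replace v_0;
   - if u = v_j with j >= 2, then e_j has, since r >= k, a vertex w off v_1 v_2 ...,
     and w e_j v_(j-1) ... v_1 e_1 v_j e_(j+1) ... is again a longest path. If w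
     lies in e_1, or already served for another v_i, i < j, a further rotation
     yields the start v_(j-1) instead.

   Deleting such r - 1 vertices gives the upper bound by induction. In the case
   of equality the rest is a block tree by induction, in which any two vertices
   are joined by a path with at least k - 1 hyperedges; hence the k - 1 deleted
   hyperedges all consist of the deleted vertices and one common vertex z, i.e.
   they form a new pendant block. *)

Set Implicit Arguments.
Unset Strict Implicit.
Unset Printing Implicit Defensive.

(** * Longest paths in the incidence graph *)

Section IncidenceGraph.
Variables (V E : finType) (inc : E -> {set V}).
Local Notation node := (V + E)%type.
Implicit Types (a b : node) (s p q : seq node) (x y z w : V) (e f : E).

Definition inc_adj : rel node := fun a b =>
  match a, b with
  | inl x, inr e => x \in inc e
  | inr e, inl x => x \in inc e
  | _, _ => false
  end.

Lemma inc_adj_sym : symmetric inc_adj.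
Proof. by case=> [x|e] [y|f]. Qed.

Definition is_vertex a := if a is inl _ then true else false.

Lemma inc_adj_alt a b : inc_adj a b -> is_vertex b = ~~ is_vertex a.
Proof. by case: a b => [x|e] [y|f]. Qed.

Lemma path_alt a p i : path inc_adj a p -> i <= size p ->
  is_vertex (nth a (a :: p) i) = is_vertex a (+) odd i.
Proof.
move=> ap; elim: i => [|i IH] ip; first by rewrite addbF.
have /inc_adj_alt := (pathP a ap) i ip.
by rewrite /= => ->; rewrite IH ?(ltnW ip) // addbN.
Qed.

Lemma index_alt a p b : path inc_adj a p -> b \in a :: p ->
  is_vertex b = is_vertex a (+) odd (index b (a :: p)).
Proof.
move=> ap bp; rewrite -(path_alt ap); last by move: bp; rewrite -index_mem.
by rewrite nth_index.
Qed.

Lemma sorted_rev_adj s : sorted inc_adj (rev s) = sorted inc_adj s.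
Proof. by rewrite rev_sorted; apply: eq_sorted => a b; rewrite /= inc_adj_sym. Qed.

(* The halves of distinct odd indices are distinct. *)
Lemma card_odd_index (T : finType) (g : T -> node) (X : {set T}) s (m : nat) :
  injective g ->
  (forall t, t \in X -> [/\ g t \in s, odd (index (g t) s) & index (g t) s < m.*2]) ->
  #|X| <= m.
Proof.
move=> inj_g Xs; pose h t := (index (g t) s)./2.
have h_inj : {in X &, injective h}.
  move=> t u /Xs[ts ot _] /Xs[us ou _] htu; apply: inj_g.
  rewrite -(nth_index (g t) ts) -[RHS](nth_index (g t) us); congr nth.
  by rewrite -(odd_double_half (index (g t) s)) -(odd_double_half (index (g u) s)) ot ou -/(h t) -/(h u) htu.
rewrite cardE -(size_map h) -[m in leqRHS](size_iota 0).
apply: uniq_leq_size.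
  by rewrite map_inj_in_uniq ?enum_uniq // => t u; rewrite !mem_enum; apply: h_inj.
move=> _ /mapP[t + ->]; rewrite mem_enum => /Xs[_ _ lt].
by rewrite mem_iota add0n /h; lia.
Qed.

(** * Chords of paths when there is no long cycle *)

Section NoLongCycle.
Variables (k : nat).
Hypothesis no_long : forall s, cycle inc_adj s -> uniq s -> size s < k.*2.

(** The piece of the path from [a] to [b], closed by the chord, is a cycle with one node more than
    the index of [b]. *)
Lemma chord_index a p b : path inc_adj a p -> uniq (a :: p) -> b \in p ->
  inc_adj a b -> (index b (a :: p)).+1 < k.*2.
Proof.
move=> ap up bp ab.
have b_ap : b \in a :: p by rewrite inE bp orbT.
set i := index b (a :: p).
have ip : i < size (a :: p) by rewrite index_mem.
have bna : a != b by apply: contraL bp => /eqP <-; case/andP: up.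
have i0 : i = (index b p).+1 by rewrite /i /= (negPf bna).
have := @no_long (take i.+1 (a :: p)); rewrite size_take_min (minn_idPl ip); apply.
  rewrite i0 /= rcons_path take_path //.
  rewrite inc_adj_sym (take_nth a); last by rewrite index_mem.
  by rewrite last_rcons nth_index.
exact: take_uniq.
Qed.

(** A vertex of [e] on the path has an odd index, which [chord_index] bounds by 2k - 3. There are
    only k - 1 such positions, fewer than the vertices of [e]. *)
Lemma edge_escapes e p : k <= #|inc e| -> path inc_adj (inr e) p ->
  uniq (inr e :: p) -> exists2 x, x \in inc e & inl x \notin p.
Proof.
move=> ke ep up; apply/exists_inP; apply: contraLR ke.
rewrite negb_exists_in => /'forall_in_negPf/= all_p.
(* The empty sequence counts as a cycle, so [no_long] yields [0 < k]. *)
have k0 : 0 < k by have := @no_long [::] isT isT; rewrite double_gt0.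
rewrite -ltnNge -(prednK k0) ltnS.
apply: (@card_odd_index _ inl _ (inr e :: p)); first by move=> x y [].
move=> x xe; have xp : inl x \in p by have := all_p x xe; case: (_ \in _).
have xep : inl x \in inr e :: p by rewrite inE xp orbT.
have ox : odd (index (inl x) (inr e :: p)) by have := index_alt ep xep.
split=> //; move: (chord_index ep up xp xe) ox; clear.
by move: (index _ _) => i; lia.
Qed.

(** * Longest paths and their starting vertices *)

Section LongestPath.
Variables (D : {set E}) (r : nat).
Hypotheses (k_ge2 : 1 < k) (k_le_r : k <= r).
Hypothesis card_D : forall e, e \in D -> #|inc e| = r.

(** Paths may use hyperedges of [D] only. Deleting hyperedges then just shrinks [D], while [inc] and
    [no_long] stay fixed. *)
Definition in_dom a := if a is inr e then e \in D else true.
Definition dpath s := [&& sorted inc_adj s, uniq s & all in_dom s].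

Lemma dpath_cons a b p : inc_adj a b -> a \notin b :: p -> in_dom a ->
  dpath (b :: p) -> dpath (a :: b :: p).
Proof. by rewrite /dpath => ab abp da /and3P[sp up dp]; apply/and3P; split; rewrite [X in is_true X]/= ?ab ?abp ?da. Qed.

Lemma dpath_behead a p : dpath (a :: p) -> dpath p.
Proof.
case/and3P=> /path_sorted sp /= /andP[_ up] /andP[_ dp].
by apply/and3P.
Qed.

Lemma dpath_rev s : dpath (rev s) = dpath s.
Proof. by rewrite /dpath sorted_rev_adj rev_uniq all_rev. Qed.

(** This is a Pósa rotation: the chord from the start [a] to [b] allows the piece before [b] to be
    reversed. *)
Lemma dpath_rot a p b q : dpath (a :: p ++ b :: q) -> inc_adj a b ->
  dpath (rev (a :: p) ++ b :: q).
Proof.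
move=> /and3P[sp up dp] ab; apply/and3P; split.
- rewrite -[a :: _]/((a :: p) ++ b :: q) in sp.
  rewrite rev_cons cat_rcons sorted_cat_cons -rev_cons sorted_rev_adj /= ab.
  by move: sp; rewrite /= cat_path /= => /and3P[-> _ ->].
- by rewrite (perm_uniq (_ : perm_eq _ ((a :: p) ++ b :: q))) // perm_cat2r perm_rev.
- by rewrite all_cat all_rev -all_cat.
Qed.

Lemma longest_dpath :
  exists2 s, dpath s & forall s', dpath s' -> size s' <= size s.
Proof.
pose P n := [exists t : n.-tuple node, dpath t].
have exP : exists n, P n by exists 0; apply/existsP; exists [tuple].
have bP n : P n -> n <= #|{: node}|.
  case/existsP=> t /and3P[_ /card_uniqP ut _].
  by rewrite -(size_tuple t) -ut max_card.
case: (ex_maxnP exP bP) => n /existsP[t dt] max_n.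
exists t => // s' ds'; rewrite size_tuple; apply: max_n.
by apply/existsP; exists (in_tuple s').
Qed.

Variable L : nat.
Hypothesis max_L : forall s, dpath s -> size s <= L.
Definition longest s := dpath s && (size s == L).

(** A hyperedge at the start would have, by [edge_escapes], a vertex off the path that could be put
    in front. *)
Lemma longest_head s : longest s -> 0 < L -> exists x p, s = inl x :: p.
Proof.
case/andP=> ds /eqP sL; case: s ds sL => [|[x|e] p] ds sL L0; [by rewrite -sL in L0 | by exists x, p | ].
have [/= ep up /andP[eD _]] := and3P ds.
have [|x xe xp] := @edge_escapes e p _ ep up; first by rewrite card_D.
have xep : inl x \notin inr e :: p by rewrite inE.
by have := max_L (@dpath_cons (inl x) (inr e) p xe xep isT ds); rewrite -sL ltnn.
Qed.

(** A hyperedge through the start is on the path, since otherwise it would extend it; [chord_index]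
    then bounds its position. *)
Lemma longest_start x p f : longest (inl x :: p) -> f \in D -> x \in inc f ->
  inr f \in take k.*2.-1 (inl x :: p).
Proof.
case/andP=> dp /eqP sL fD xf; have [/= xp up dom_p] := and3P dp.
have fp : inr f \in p.
  apply: contraT => fp.
  have fxp : inr f \notin inl x :: p by rewrite inE.
  by have := max_L (@dpath_cons (inr f) (inl x) p xf fxp fD dp); rewrite -sL ltnn.
rewrite in_take; last by rewrite inE fp orbT.
by move: (chord_index xp up fp xf); move: (index _ _) => i; clear; lia.
Qed.

(** On a path v_0 e_1 v_1 ... the first 2k - 1 nodes end at v_(k-1), so these are e_1, ...,
    e_(k-1). *)
Definition early_edges s : {set E} := [set e | inr e \in take k.*2.-1 s].

(** Requiring some hyperedge of [D] at the vertex keeps it inside every set that contains all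
    hyperedges of [D]. *)
Definition light (F : {set E}) : {set V} :=
  [set x | [exists e in D, x \in inc e] && [forall e in D, (x \in inc e) ==> (e \in F)]].

Lemma card_early_edges x p : path inc_adj (inl x) p -> #|early_edges (inl x :: p)| <= k.-1.
Proof.
move=> xp; apply: (@card_odd_index _ inr _ (inl x :: p)); first by move=> ? ? [].
move=> e; rewrite inE => et; have es := mem_take et.
rewrite in_take // in et.
have oe : odd (index (inr e) (inl x :: p)).
  by move: (index_alt xp es) => /=; case: odd.
split=> //; move: oe et k_ge2; clear; move: (index _ _) => i; lia.
Qed.

(** A hyperedge through the start of the second path is early there by [longest_start]. Either it is
    in [a2], hence in [a1], or it has the same position in both paths, the heads being equally
    long. *)
Lemma longest_light (a1 a2 b : seq node) x p : longest (a1 ++ b) -> longest (a2 ++ b) ->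
  size a1 = size a2 -> size a1 <= k.*2.-1 ->
  (forall e, inr e \in a2 -> inr e \in a1) ->
  a2 ++ b = inl x :: p -> 1 < L -> x \in light (early_edges (a1 ++ b)).
Proof.
move=> l1 l2 sa a1k sub xp L1; rewrite xp in l2; rewrite inE; apply/andP; split.
  case/andP: l2 => /and3P[/= xp' _ dp] /eqP sL.
  case: p sL xp' dp {xp} => [|[y|e] p] /= sL; first by rewrite -sL in L1.
    by [].
  by case/andP=> xe _ /andP[eD _]; apply/exists_inP; exists e.
apply/forall_inP=> e eD; apply/implyP=> xe.
have := longest_start l2 eD xe; rewrite inE -xp.
by rewrite !take_cat -sa !ltnNge a1k /= !mem_cat => /orP[/sub->|->]; rewrite ?orbT.
Qed.

(** * Rotations of a longest path *)

Section Rotations.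
Variables (v0 v1 : V) (e1 : E) (q q0 : seq node).
Hypothesis q_head : q = inl v1 :: q0.
Hypothesis longest_path : longest [:: inl v0, inr e1 & q].

(** For x = v_j in e_1 with j >= 2, these are its position in [q], then v_(j-1), e_j and a vertex of
    e_j off [q]. The defaults [v0] and [e1] are not reached for such x. *)
Let index_q x := index (inl x) q.
Let vertex_before x := if nth (inl v0) q (index_q x - 2) is inl y then y else v0.
Let edge_before x := if nth (inl v0) q (index_q x).-1 is inr e then e else e1.
Let escape x := odflt v0 [pick w in inc (edge_before x) | inl w \notin q].
Let chord x := [&& x \in inc e1, inl x \in q & x != v1].

Let dpath_e1q : dpath (inr e1 :: q).
Proof. by case/andP: longest_path => /dpath_behead. Qed.

(** The bound comes from the chord between [e1] and [x], which has index [(size q1).+3] on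
    [inr e1 :: q]. It is the bound on the head that [longest_light] demands. *)
Lemma chord_split x : chord x -> exists q1 q2,
  [/\ q = q1 ++ [:: inl (vertex_before x), inr (edge_before x), inl x & q2],
      index_q x = (size q1).+2 & (size q1).+4 <= k.*2.-1].
Proof.
case/and3P=> xe1 xq xv1.
have /and3P[/= sq uq _] := dpath_e1q; have [_ uqq] := andP uq.
suff [q1 [y [e [q2 def_q]]]] : exists q1 y e q2, q = q1 ++ [:: inl y, inr e, inl x & q2].
  have idx : index_q x = (size q1).+2.
    move: (uqq); rewrite /index_q def_q cat_uniq => /and3P[_ q1N _].
    rewrite index_cat; case: ifP => [xq1|_].
      by case/hasP: q1N; exists (inl x); rewrite // !inE eqxx !orbT.
    move: uqq; rewrite def_q cat_uniq => /and3P[_ _ /=].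
    rewrite !inE !negb_or => /andP[/and3P[_ yx _] _].
    by rewrite (negPf yx) eqxx addn2.
  exists q1, q2; rewrite idx; split=> //.
    rewrite {1}def_q /vertex_before /edge_before idx def_q subn2 /= !nth_cat.
    by rewrite ltnn subnn ltnNge leqnSn subSnn.
  have := chord_index sq uq xq xe1; rewrite /= -/(index_q x) idx.
  by clear; lia.
(* Vertices and hyperedges alternate, so [x] is preceded by a hyperedge and a vertex; an empty
   prefix would make it [v1]. *)
move: xv1 q_head sq; case/path.splitPr: xq => p1 p2.
case/lastP: p1 => [|p1 a]; first by move=> /eqP xv1 [/xv1].
rewrite cat_rcons; case: a => [y|e]; first by rewrite cat_path /= !andbF.
case/lastP: p1 => [|p1 a] //; rewrite cat_rcons; case: a => [y|f].
  by move=> *; exists p1, y, e, p2.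
by rewrite cat_path /= !andbF.
Qed.

(* For [x] = v_j: the path e_j v_(j-1) ... v_1 e_1 v_j e_(j+1) ... *)
Let rotated q1 x q2 :=
  [:: inr (edge_before x), inl (vertex_before x) & rev (inr e1 :: q1) ++ inl x :: q2].

Lemma dpath_rotated x q1 q2 : chord x ->
  q = q1 ++ [:: inl (vertex_before x), inr (edge_before x), inl x & q2] ->
  dpath (rotated q1 x q2) /\ perm_eq (rotated q1 x q2) (inr e1 :: q).
Proof.
move=> /and3P[xe1 _ _] def_q; rewrite /rotated.
set y := vertex_before x in def_q *; set e := edge_before x in def_q *.
have def_rot : [:: inr e, inl y & rev (inr e1 :: q1) ++ inl x :: q2]
    = rev (inr e1 :: rcons (rcons q1 (inl y)) (inr e)) ++ inl x :: q2.
  by rewrite -!rcons_cons !rev_rcons.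
have def_e1q : inr e1 :: q = (inr e1 :: rcons (rcons q1 (inl y)) (inr e)) ++ inl x :: q2.
  by rewrite /= !cat_rcons -def_q.
rewrite def_rot; split; last by rewrite def_e1q perm_cat2r perm_rev.
by apply: dpath_rot => //; move: dpath_e1q; rewrite def_e1q.
Qed.

(** The rotated path starts at e_j and has the same nodes as [inr e1 :: q], so [edge_escapes]
    applies to it. *)
Lemma escapeP x : chord x -> escape x \in inc (edge_before x) /\ inl (escape x) \notin q.
Proof.
move=> cx; rewrite /escape; case: pickP => [w /andP[] //|no_w].
have [q1 [q2 [def_q _ _]]] := chord_split cx.
have [/and3P[ep up /andP[eD _]] perm_p] := dpath_rotated cx def_q.
have [|w we wp] := @edge_escapes (edge_before x) (behead (rotated q1 x q2)) _ ep up; first by rewrite card_D.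
suff : (w \in inc (edge_before x)) && (inl w \notin q) by rewrite no_w.
rewrite we; apply: contra wp => wq; have := perm_mem perm_p (inl w).
by rewrite inE /= [RHS]inE wq => ->.
Qed.

Lemma longest_rotated x q1 q2 w : chord x ->
  q = q1 ++ [:: inl (vertex_before x), inr (edge_before x), inl x & q2] ->
  w \in inc (edge_before x) -> inl w \notin q -> longest (inl w :: rotated q1 x q2).
Proof.
move=> cx def_q we wq; have [dp perm_p] := dpath_rotated cx def_q.
apply/andP; split; last first.
  by case/andP: longest_path => _ /eqP <-; apply/eqP; exact: (congr1 S (perm_size perm_p)).
apply: dpath_cons => //.
by rewrite (perm_mem perm_p) inE.
Qed.

Let F := early_edges [:: inl v0, inr e1 & q].

Lemma path_long : 1 < L.
Proof. by case/andP: longest_path => _ /eqP <-. Qed.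

Lemma light_first_edge u : u \in inc e1 -> inl u \notin q -> u \in light F.
Proof.
move=> ue uq; apply: (@longest_light [:: inl v0; inr e1] [:: inl u; inr e1] q u (inr e1 :: q)) => //.
- case/andP: longest_path => _ /eqP sL; apply/andP; split; last by rewrite -sL.
  by apply: dpath_cons => //; rewrite inE.
- by move: k_ge2; clear; rewrite /=; lia.
- exact: path_long.
Qed.

(** The path w e_j v_(j-1) ... v_1 e_1 v_j ... agrees with the original one from v_j on, and its
    head uses only e_1, ..., e_j. *)
Lemma light_escape x : chord x -> escape x \in light F.
Proof.
move=> cx; have [we wq] := escapeP cx; have [q1 [q2 [def_q _ szq]]] := chord_split cx.
set y := vertex_before x in def_q *; set e := edge_before x in def_q we *.
rewrite /F def_q.
have -> : [:: inl v0, inr e1 & q1 ++ [:: inl y, inr e, inl x & q2]] =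
  [:: inl v0, inr e1 & q1 ++ [:: inl y; inr e]] ++ inl x :: q2 by rewrite /= -catA.
have lr := longest_rotated cx def_q we wq.
apply: (@longest_light _ [:: inl (escape x), inr e, inl y & rev (inr e1 :: q1)]).
- by rewrite /= -catA -def_q.
- exact: lr.
- by rewrite /= size_cat size_rev /= addn2.
- by rewrite /= size_cat /= addn2.
- by move=> f; rewrite !inE mem_cat mem_rev !inE; case: (_ == inr e1); case: (_ == inr e); rewrite ?orbT //= ?orbF.
- by [].
- exact: path_long.
Qed.

Lemma split_at_index x (p1 p2 : seq node) : uniq q -> q = p1 ++ inl x :: p2 ->
  p1 = take (index_q x) q /\ p2 = drop (index_q x).+1 q.
Proof.
move=> uq def_q; suff -> : index_q x = size p1.
  by rewrite def_q take_size_cat // -cat_rcons drop_size_cat // size_rcons.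
rewrite /index_q def_q index_cat /= eqxx addn0 ifN //.
by move: uq; rewrite def_q cat_uniq /= negb_or => /and3P[_ /andP[]].
Qed.

(** In both cases some longest path goes from the escape w through e_1, ..., e_(j-1) in some order
    to v_(j-1) e_j v_j .... As w lies in e_j, a rotation makes v_(j-1) the start. *)
Lemma light_vertex_before x : chord x ->
  (escape x \in inc e1) ||
    [exists (x' | chord x'), (index_q x' < index_q x) && (escape x' == escape x)] ->
  vertex_before x \in light F.
Proof.
move=> cx; have [we wq] := escapeP cx; have [q1 [q2 [def_q ix szq]]] := chord_split cx.
have /and3P[_ /= /andP[_ uq] _] := dpath_e1q.
have max_size : size [:: inl v0, inr e1 & q] = L by case/andP: longest_path => _ /eqP.
set y := vertex_before x in def_q *; set e := edge_before x in def_q we *.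
set w := escape x in we wq *.
have def_q' : q = rcons q1 (inl y) ++ [:: inr e, inl x & q2] by rewrite cat_rcons.
(* The rotation common to both cases; [m] is the piece between w and v_(j-1). *)
have F_rev m : dpath ((inl w :: rcons m (inl y)) ++ [:: inr e, inl x & q2]) ->
    size m = (size q1).+1 -> (forall f, inr f \in m -> inr f \in inr e1 :: q1) ->
    y \in light F.
  move=> dp szm sub_m; rewrite /F.
  have -> : [:: inl v0, inr e1 & q] = [:: inl v0, inr e1 & rcons (rcons q1 (inl y)) (inr e)] ++ inl x :: q2.
    by rewrite def_q /= !cat_rcons.
  have size_q : (size q1).+3 + (size q2).+2 = L.
    by rewrite -max_size /= def_q size_cat /=; clear; lia.
  apply: (@longest_light _ (rcons (rev (inl w :: rcons m (inl y))) (inr e))).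
  - by rewrite /= !cat_rcons -def_q.
  - apply/andP; split; last first.
      by rewrite size_cat size_rcons size_rev /= size_rcons szm -size_q; clear; apply/eqP; lia.
    by rewrite cat_rcons; apply: dpath_rot.
  - by rewrite !size_rcons size_rev /= !size_rcons szm.
  - by rewrite /= !size_rcons.
  - move=> f; have := sub_m f; rewrite !(mem_rcons, inE, mem_rev).
    have nv u : (inr f == inl u :> node) = false by [].
    rewrite !nv; case: (inr f \in m) => [/(_ isT)/orP[]->|_]; rewrite ?orbT //.
    by case: (inr f == inr e); rewrite ?orbT.
  - by rewrite rev_cons rev_rcons.
  - exact: path_long.
case/orP=> [we1|/exists_inP[x' cx' /andP[ltx /eqP eqw]]].
  apply: (F_rev (inr e1 :: q1)) => //.
  rewrite cat_cons rcons_cons cat_cons -def_q'.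
  by apply: dpath_cons => //; rewrite inE.
(* Here w also escapes from e_i for an earlier v_i, and the path is w e_i v_(i-1) ... v_1 e_1 v_i
   ... v_(j-1) e_j v_j .... *)
have [we' wq'] := escapeP cx'; have [p1 [p2 [def_q2 ix' _]]] := chord_split cx'.
rewrite eqw -/w in we'.
have [_ xq' _] := and3P cx'.
have : inl x' \in rcons q1 (inl y).
  have : inl x' \in take (index_q x) q by rewrite in_take.
  have -> : take (index_q x) q = rcons (rcons q1 (inl y)) (inr e).
    by rewrite ix def_q -2!cat_rcons take_size_cat // !size_rcons.
  by rewrite mem_rcons inE.
move=> x'q1; have [s1 [s2 def_q1]] : exists s1 s2, rcons q1 (inl y) = s1 ++ inl x' :: s2.
  by case/path.splitPr: x'q1 => s1 s2; exists s1, s2.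
have def_q3 : q = s1 ++ inl x' :: (s2 ++ [:: inr e, inl x & q2]) by rewrite def_q' def_q1 -catA.
have [eq_s1 eq_p2] : p1 ++ [:: inl (vertex_before x'); inr (edge_before x')] = s1 /\
   p2 = s2 ++ [:: inr e, inl x & q2].
  have [-> ->] := split_at_index uq def_q3.
  by apply: split_at_index; rewrite // -catA.
have lr := longest_rotated cx' def_q2 we' wq.
pose m' := [:: inr (edge_before x'), inl (vertex_before x') & rev (inr e1 :: p1)].
have def_m : exists m, rcons m (inl y) = m' ++ inl x' :: s2.
  (* An empty [s2] is the case where v_i is v_(j-1) itself. *)
  case/lastP: s2 {def_q3 eq_p2} def_q1 => [|s2 a]; first by rewrite cats1 => /rcons_inj[_ ->]; exists m'; rewrite cats1.
  rewrite -rcons_cons -rcons_cat => /rcons_inj[_ <-].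
  by exists (m' ++ inl x' :: s2); rewrite -rcons_cat.
have [m def_m'] := def_m.
have size_m : size m = (size q1).+1.
  have := congr1 size def_q1; have := congr1 size def_m'.
  rewrite -eq_s1 !size_cat !size_rcons /= size_rev /=; clear; lia.
apply: (F_rev m) => //.
  by rewrite def_m'; case/andP: lr => + _; rewrite /rotated eq_p2 /m' /= -!catA.
move=> f fm; have : inr f \in rcons m (inl y) by rewrite mem_rcons inE fm orbT.
have -> : (inr f \in inr e1 :: q1) = (inr f \in inr e1 :: rcons q1 (inl y)) by rewrite !inE mem_rcons !inE.
rewrite def_m' def_q1 -eq_s1 /m' !(inE, mem_cat, mem_rev).
by case: (inr f \in p1); case: (inr f \in s2); case: (inr f == inr e1); case: (inr f == inr (edge_before x')); rewrite ?orbT.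
Qed.

Lemma index_q_inj x y : inl x \in q -> inl y \in q -> index_q x = index_q y -> x = y.
Proof.
move=> xq yq eq_i.
have [//] : @inl V E x = inl y by rewrite -(nth_index (inl x) xq) -(nth_index (inl x) yq) -/(index_q x) eq_i.
Qed.

Lemma index_vertex_before x : chord x ->
  inl (vertex_before x) \in q /\ index_q x = (index_q (vertex_before x)).+2.
Proof.
move=> cx; have [q1 [q2 [def_q ix _]]] := chord_split cx.
have /and3P[_ /= /andP[_ uq] _] := dpath_e1q.
have yq : inl (vertex_before x) \in q by rewrite def_q mem_cat !inE eqxx orbT.
split=> //; rewrite ix {1}/index_q def_q index_cat /= eqxx addn0 ifN //.
by move: uq; rewrite def_q cat_uniq /= negb_or => /and3P[_ /andP[]].
Qed.

(** The map [phi] sends e_1 without v_1 injectively into the light vertices. Its values v_(j-1) lie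
    on [q] and determine v_j. The others lie off [q]: they are vertices of e_1, or escapes outside
    e_1 that no earlier chord has. *)
Lemma card_light : r.-1 <= #|light F|.
Proof.
pose early_escape x := (escape x \in inc e1) ||
  [exists (x' | chord x'), (index_q x' < index_q x) && (escape x' == escape x)].
pose phi x := if inl x \notin q then x
  else if early_escape x then vertex_before x else escape x.
have e1D : e1 \in D by case/and3P: dpath_e1q => _ _ /andP[].
have chordP x : x \in inc e1 :\ v1 -> inl x \in q -> chord x.
  by rewrite 2!inE /chord => /andP[-> ->] ->.
have inj_phi : {in inc e1 :\ v1 &, injective phi}.
  (* By symmetry, x is off [q], or both are on [q] and x does not come after y. *)
  suff H x y : x \in inc e1 :\ v1 -> y \in inc e1 :\ v1 -> phi x = phi y ->
      (inl x \in q) ==> (inl y \in q) && (index_q x <= index_q y) -> x = y.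
    move=> x y xX yX eqxy; case: (boolP (inl x \in q)) => xq; last by apply: H; rewrite ?(negPf xq).
    case: (boolP (inl y \in q)) => yq; last by apply/esym/H; rewrite ?(negPf yq).
    case: (leqP (index_q x) (index_q y)) => [|/ltnW] le; first by apply: H; rewrite ?xq ?yq.
    by apply/esym/H; rewrite ?xq ?yq.
  move=> xX yX; have xe1 := subsetP (subD1set _ _) _ xX.
  have ye1 := subsetP (subD1set _ _) _ yX.
  rewrite /phi; case: (boolP (inl x \in q)) => [xq|xq] /=.
    move=> + /andP[yq le]; rewrite yq /=.
    have [cx cy] := (chordP x xX xq, chordP y yX yq).
    have [[_ xNq] [_ yNq]] := (escapeP cx, escapeP cy).
    have [[xbq ibx] [ybq iby]] := (index_vertex_before cx, index_vertex_before cy).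
    case: ifP => [_|Nx]; case: ifP => [_|Ny].
    - move=> eqb; apply: index_q_inj => //; by rewrite ibx iby eqb.
    - by move=> eqb; rewrite -eqb xbq in yNq.
    - by move=> eqb; rewrite eqb ybq in xNq.
    - move=> eqw; case: (ltngtP (index_q x) (index_q y)) le => // [lt _|eqi _].
        case/negP: Ny; apply/orP; right; apply/exists_inP; exists x => //.
        by rewrite lt eqw eqxx.
      exact: index_q_inj.
  case: (boolP (inl y \in q)) => [yq|//] /=.
  have cy := chordP y yX yq; have [ybq _] := index_vertex_before cy.
  case: ifP => [_|/norP[yN _]] eqx; first by rewrite -eqx (negPf xq) in ybq.
  by rewrite -eqx xe1 in yN.
apply: leq_trans (_ : #|phi @: (inc e1 :\ v1)| <= _).
  rewrite card_in_imset // -(card_D e1D) (cardsD1 v1 (inc e1)).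
  by case: (v1 \in inc e1); rewrite ?add1n ?add0n /= ?leq_pred.
apply: subset_leq_card; apply/subsetP=> _ /imsetP[x xX ->]; rewrite /phi.
have xe1 := subsetP (subD1set _ _) _ xX.
case: ifPn => [xq|/negPn xq]; first exact: light_first_edge.
by case: ifP => [|_]; [apply: light_vertex_before | apply: light_escape]; apply: chordP.
Qed.

End Rotations.
End LongestPath.

Theorem few_edges_around_set (D : {set E}) r : 1 < k -> k <= r ->
  (forall e, e \in D -> #|inc e| = r) -> D != set0 ->
  exists (S : {set V}) (F : {set E}), [/\ #|S| = r.-1, F \subset D, #|F| <= k.-1,
    forall x, x \in S -> exists2 e, e \in D & x \in inc e &
    forall x e, x \in S -> e \in D -> x \in inc e -> e \in F].
Proof.
move=> k_ge2 k_le_r card_D /set0Pn[e eD].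
have [s ds max_s] := longest_dpath D.
have long s' : dpath D s' -> size s' = size s -> longest D (size s) s'.
  by move=> d eqs; rewrite /longest d eqs eqxx.
have s_gt0 : 0 < size s by apply: (max_s [:: inr e]); rewrite /dpath /= eD.
have [v0 [p def_s]] := longest_head k_le_r card_D max_s (long s ds erefl) s_gt0.
(* The reversed path is longest too, so the last node is also a vertex. This excludes the path v_0
   e_1; a single vertex is excluded because a vertex followed by a hyperedge is longer. *)
have rev_long := long (rev s) (etrans (dpath_rev _ _) ds) (size_rev s).
have [v' [p' def_r]] := longest_head k_le_r card_D max_s rev_long s_gt0.
have /and3P[sp up /allP dp] := ds.
have [e1 [v1 [q0 def_s']]] : exists e1 v1 q0, s = [:: inl v0, inr e1, inl v1 & q0].
  move: sp def_r; rewrite def_s; case: p def_s => [|[y|e1] [|[v1|f] q0]] def_s //= sp.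
  - have /card_gt0P[x xe] : 0 < #|inc e| by rewrite card_D //; lia.
    by have := max_s [:: inl x; inr e]; rewrite def_s /dpath /= xe eD => /(_ isT).
  - by move=> _; exists e1, v1, q0.
  - by rewrite andbF in sp.
have ls := long s ds erefl; rewrite {2}def_s' in ls.
have := card_light k_ge2 k_le_r card_D max_s erefl ls.
set F := early_edges _; case/card_geqP=> xs [uxs size_xs sub_xs].
exists [set x in xs], F; split.
- by rewrite cardsE (card_uniqP uxs).
- by apply/subsetP=> f; rewrite inE => /mem_take; rewrite -def_s' => /dp.
- by apply: card_early_edges; rewrite // def_s' in sp.
- by move=> x; rewrite inE => /sub_xs; rewrite inE => /andP[/exists_inP].
- move=> x f; rewrite inE => /sub_xs; rewrite inE => /andP[_ /forall_inP xF] fD.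
  exact/implyP/xF.
Qed.

End NoLongCycle.
End IncidenceGraph.

(** * The upper bound and the case of equality *)

Section Extremal.
Variables (V E : finType) (inc : E -> {set V}) (k r : nat).
Hypotheses (k_ge2 : 1 < k) (k_le_r : k <= r).
Local Notation node := (V + E)%type.
Local Notation adj := (inc_adj inc).
Implicit Types (U S Z : {set V}) (D F : {set E}).

Definition spans U D := forall e, e \in D -> inc e \subset U /\ #|inc e| = r.

(** Block trees in constructive form: each step glues to a vertex [z] a pendant block [z |: S]
    carrying k - 1 copies of one hyperedge. *)
Inductive btree : {set V} -> {set E} -> Prop :=
| btree1 z : btree [set z] set0
| btree_add U D z S F : btree U D -> z \in U -> [disjoint S & U] ->
    #|S| = r.-1 -> [disjoint F & D] -> #|F| = k.-1 ->
    (forall f, f \in F -> inc f = z |: S) -> btree (S :|: U) (F :|: D).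

Definition inside U D (a : node) :=
  match a with inl x => x \in U | inr e => e \in D end.

(** * Long paths in block trees *)

Definition long_path U D x y := exists p, [/\ path adj (inl x) p,
  last (inl x) p = inl y, uniq (inl x :: p), all (inside U D) (inl x :: p)
  & k.-1.*2 <= size p].

Lemma long_path_sym U D x y : long_path U D x y -> long_path U D y x.
Proof.
case=> p [xp lastp up dp szp]; exists (rev (belast (inl x) p)).
have def_rev : rev (inl x :: p) = inl y :: rev (belast (inl x) p).
  by rewrite lastI rev_rcons lastp.
rewrite -def_rev rev_uniq all_rev size_rev size_belast; split=> //.
  rewrite -lastp rev_path -(eq_path (e := adj)) // => a b.
  exact: inc_adj_sym.
by case: (p) lastp => [|a q] //= _; rewrite rev_cons last_rcons.
Qed.

Lemma long_path_mono U D U' D' x y : U \subset U' -> D \subset D' ->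
  long_path U D x y -> long_path U' D' x y.
Proof.
move=> /subsetP sU /subsetP sD [p [xp lastp up /allP dp szp]]; exists p; split=> //.
by apply/allP=> -[z|e] /dp; [apply: sU | apply: sD].
Qed.

Fixpoint weave (es : seq E) (vs : seq V) : seq node :=
  match es, vs with e :: es', v :: vs' => [:: inr e, inl v & weave es' vs'] | _, _ => [::] end.

Lemma weave_path Z es vs x : x \in Z -> {subset vs <= Z} ->
  (forall e, e \in es -> inc e = Z) -> path adj (inl x) (weave es vs).
Proof.
elim: es vs x => [|e es IH] [|v vs] x xZ sub_vs incZ //=.
have vZ : v \in Z by apply: sub_vs; rewrite inE eqxx.
rewrite incZ ?inE ?eqxx // xZ vZ IH // => [w wvs|f fes]; [apply: sub_vs | apply: incZ].
  by rewrite inE wvs orbT.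
by rewrite inE fes orbT.
Qed.

Lemma weave_vertex es vs x : size es = size vs -> (inl x \in weave es vs) = (x \in vs).
Proof. by elim: es vs => [|e es IH] [|v vs] //= [/IH]; rewrite !inE => ->. Qed.

Lemma weave_edge es vs e : size es = size vs -> (inr e \in weave es vs) = (e \in es).
Proof. by elim: es vs => [|f es IH] [|v vs] //= [/IH]; rewrite !inE => ->. Qed.

Lemma weave_uniq es vs : size es = size vs -> uniq es -> uniq vs -> uniq (weave es vs).
Proof.
elim: es vs => [|e es IH] [|v vs] //= [eq_sz] /andP[ees ues] /andP[vvs uvs].
by rewrite inE weave_vertex // weave_edge // ees vvs IH.
Qed.

Lemma weave_last es vs x : size es = size vs -> last (inl x) (weave es vs) = inl (last x vs).
Proof. by elim: es vs x => [|e es IH] [|v vs] x //= [/IH]. Qed.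

Lemma weave_size es vs : size es = size vs -> size (weave es vs) = (size es).*2.
Proof. by elim: es vs => [|e es IH] [|v vs] //= [/IH->]. Qed.

(** The path uses all k - 1 copies, passes through k - 2 of the r - 2 other vertices and ends at
    [y]. *)
Lemma block_long_path Z F x y : #|Z| = r -> #|F| = k.-1 ->
  (forall f, f \in F -> inc f = Z) -> x \in Z -> y \in Z -> x != y ->
  long_path Z F x y.
Proof.
move=> cZ cF incF xZ yZ xy.
pose es := enum F; pose vs := rcons (take k.-2 (enum (Z :\ x :\ y))) y.
have sub_vs v : v \in vs -> (v == y) || [&& v != x, v != y & v \in Z].
  rewrite mem_rcons inE => /orP[->//|/mem_take]; rewrite mem_enum !inE.
  by case/and3P=> -> -> ->; rewrite orbT.
have size_es : size es = k.-1 by rewrite /es -cardE.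
have size_vs : size es = size vs.
  rewrite size_es size_rcons size_take_min -cardE.
  have := cardsD1 x Z; have := cardsD1 y (Z :\ x).
  by rewrite !inE xZ yZ eq_sym xy cZ /= => e1 e2; rewrite (minn_idPl _); move: k_ge2 k_le_r e1 e2; clear; lia.
exists (weave es vs); split.
- apply: (@weave_path Z) => // [v /sub_vs/orP[/eqP->//|/and3P[]//]|f].
  by rewrite mem_enum; apply: incF.
- by rewrite weave_last // last_rcons.
- rewrite /= weave_uniq ?enum_uniq ?andbT //.
    rewrite weave_vertex //; apply/negP=> /sub_vs.
    by rewrite eqxx (negPf xy).
  rewrite rcons_uniq take_uniq ?enum_uniq // andbT.
  by apply/negP=> /mem_take; rewrite mem_enum !inE eqxx.
- rewrite /= xZ; apply/allP=> -[v|f] /=.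
    by rewrite weave_vertex // => /sub_vs /orP[/eqP->|/and3P[]].
  by rewrite weave_edge // mem_enum.
- by rewrite weave_size // size_es.
Qed.

(** Two vertices of the new block are joined inside it. From a new vertex to an old one other than
    [z], one new hyperedge leads to [z], where a long path of the old tree continues. *)
Lemma btree_long_path U D x y : btree U D -> x \in U -> y \in U -> x != y ->
  long_path U D x y.
Proof.
move=> bUD; elim: bUD x y => [z|{}U {}D z S F _ IH zU dSU cS dFD cF incF] x y.
  by rewrite !inE => /eqP-> /eqP->; rewrite eqxx.
have zS : z \notin S by apply: contraL zU => zS; rewrite (disjointFr dSU).
have cZ : #|z |: S| = r by rewrite cardsU1 zS cS; move: k_ge2 k_le_r; clear; lia.
have sub_path := @long_path_mono _ _ (S :|: U) (F :|: D).
have inZ u v : u \in z |: S -> v \in z |: S -> u != v -> long_path (S :|: U) (F :|: D) u v.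
  move=> uZ vZ uv; apply: (sub_path (z |: S) F); rewrite ?subsetUl //.
    by rewrite setUC setUS // sub1set.
  exact: block_long_path.
have mixed u v : u \in S -> v \in U -> long_path (S :|: U) (F :|: D) u v.
  move=> uS vU; have [<-|vz] := eqVneq z v.
    by apply: inZ; rewrite ?inE ?eqxx ?uS ?orbT //; apply: contraNneq zS => <-.
  have [p [zp lastp up dp szp]] := IH z v zU vU vz.
  have [f fF] : exists f, f \in F by apply/card_gt0P; rewrite cF; move: k_ge2; clear; lia.
  have uU : u \notin U by rewrite (disjointFr dSU).
  exists [:: inr f, inl z & p]; split=> //.
  - by rewrite /= incF // !inE eqxx uS orbT.
  - have no a : ~~ inside U D a -> a \notin inl z :: p by apply: contra => /(allP dp).
    have nu : inl u \notin inl z :: p by apply: no; rewrite /= uU.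
    have nf : inr f \notin inl z :: p by apply: no; rewrite /= (disjointFr dFD).
    by rewrite cons_uniq inE negb_or nu [uniq (inr f :: _)]cons_uniq nf up.
  - rewrite /= !inE uS fF zU orbT /=; apply: sub_all (_ : all (inside U D) p); last by case/andP: dp.
    by case=> [w|e] /=; rewrite inE => ->; rewrite orbT.
  - by rewrite /= (leq_trans szp) // ltnW.
rewrite !inE => /orP[xS|xU] /orP[yS|yU] xy.
- by apply: inZ; rewrite // inE ?xS ?yS orbT.
- exact: mixed.
- exact/long_path_sym/mixed.
- by apply: (sub_path U D); rewrite ?subsetUr //; apply: IH.
Qed.


(** * Deleting a light set *)

Hypothesis no_long : forall s, cycle adj s -> uniq s -> size s < k.*2.

Lemma remove_light U D : spans U D -> D != set0 -> exists S F,
  [/\ S \subset U, F \subset D, #|S| = r.-1, #|F| <= k.-1 &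
   [/\ spans (U :\: S) (D :\: F), U :\: S != set0 &
    #|U|.-1 = #|U :\: S|.-1 + r.-1]].
Proof.
move=> UD D0; have cD e : e \in D -> #|inc e| = r by case/UD.
have [S [F [cS sF cF S_used S_only]]] := few_edges_around_set no_long k_ge2 k_le_r cD D0.
have sS : S \subset U.
  by apply/subsetP=> x /S_used[e /UD[/subsetP eU _] /eU].
have [e eD] := set0Pn _ D0; have [eU ce] := UD e eD.
have cU := subset_leq_card eU; have cUS : #|U :\: S| = #|U| - r.-1 by rewrite cardsD (setIidPr sS) cS.
have c0 : 0 < #|U :\: S| by move: cU k_ge2 k_le_r; rewrite cUS ce; clear; lia.
exists S, F; split=> //; split.
- move=> f; rewrite inE => /andP[fF fD]; have [fU ->] := UD f fD; split=> //.
  rewrite subsetD fU; apply/pred0P=> x /=; apply/negP=> /andP[xf xS].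
  by case/negP: fF; apply: S_only xf.
- by rewrite -card_gt0.
- by move: cUS c0 cU k_ge2 k_le_r; rewrite ce; clear; lia.
Qed.

Lemma divn_remove (m n : nat) : m = n + r.-1 -> m %/ r.-1 = (n %/ r.-1).+1.
Proof.
have r1 : 0 < r.-1 by move: k_ge2 k_le_r; clear; lia.
by move=> ->; rewrite divnDr // divnn r1 addn1.
Qed.

Lemma card_edges_le U D : spans U D -> #|D| <= #|U|.-1 %/ r.-1 * k.-1.
Proof.
have [n] := ubnP #|U|; elim: n U D => // n IH U D le_n UD.
have [->|D0] := eqVneq D set0; first by rewrite cards0.
have [S [F [sS sF cS cF [UD' U0 cU]]]] := remove_light UD D0.
rewrite (divn_remove cU) mulSn.
have := cardsD D F; rewrite (setIidPr sF).
have := IH _ _ _ UD'; have := subset_leq_card sF.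
have U0' : 0 < #|U :\: S| by rewrite card_gt0.
have -> : #|U :\: S| < n by move: le_n cU U0' k_ge2 k_le_r; clear; lia.
move=> le_FD /(_ isT); move: cF le_FD; clear; move: (_ * _) => q; lia.
Qed.

Lemma extremal_btree U D : spans U D -> U != set0 -> r.-1 %| #|U|.-1 ->
  #|D| = #|U|.-1 %/ r.-1 * k.-1 -> btree U D.
Proof.
have [n] := ubnP #|U|; elim: n U D => // n IH U D le_n UD U0 dvd cD.
have [D0|D0] := eqVneq D set0.
  have /cards1P[z ->] : #|U| == 1.
    have : #|U|.-1 = 0.
      rewrite -(divnK dvd); apply/eqP; rewrite muln_eq0; move/eqP: cD.
      rewrite D0 cards0 eq_sym muln_eq0 => /orP[->//|]; move: k_ge2; clear; lia.
    by move: U0; rewrite -card_gt0; case: #|U| => [|[]].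
  by rewrite D0; apply: btree1.
have [S [F [sS sF cS cF [UD' U0' cU]]]] := remove_light UD D0.
have dvd' : r.-1 %| #|U :\: S|.-1 by move: dvd; rewrite cU dvdn_addl.
(* Equality in the total forces equality both in the deleted part and in the rest. *)
have eq_cF : #|F| = k.-1 /\ #|D :\: F| = #|U :\: S|.-1 %/ r.-1 * k.-1.
  move: cD (cardsD D F) (card_edges_le UD') (subset_leq_card sF).
  rewrite (setIidPr sF) (divn_remove cU) mulSn; move: cF; clear.
  by move: (_ * _) => q; lia.
have {cF} [cF cD'] := eq_cF.
have bt : btree (U :\: S) (D :\: F).
  apply: IH => //; move: le_n cU U0' k_ge2 k_le_r; rewrite -card_gt0; clear; lia.
have FD f : f \in F -> inc f \subset U /\ #|inc f| = r by move=> /(subsetP sF)/UD.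
have bt_path x y : x \in U :\: S -> y \in U :\: S -> x != y ->
    long_path (U :\: S) (D :\: F) x y by apply: btree_long_path.
have F_out f : f \in F -> ~~ inside (U :\: S) (D :\: F) (inr f).
  by move=> fF; rewrite /= inE fF.
(* A deleted hyperedge with two vertices outside [S] would close a long path of the remaining tree
   to a cycle with at least k hyperedges. *)
have one_out f x y : f \in F -> x \in inc f :\: S -> y \in inc f :\: S -> x = y.
  move=> fF xf yf; apply/eqP/negPn/negP=> xy.
  have [fU _] := FD f fF.
  have [p [xp lastp up /allP dp szp]] := bt_path x y (subsetP (setSD _ fU) _ xf) (subsetP (setSD _ fU) _ yf) xy.
  have := @no_long (inr f :: inl x :: p); rewrite /= rcons_path lastp /=.
  move: xf yf; rewrite !inE => /andP[_ xf] /andP[_ yf]; rewrite xf yf xp /=.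
  have -> : inr f \notin inl x :: p by apply: contra (F_out f fF) => /dp.
  move: up => /= -> /(_ isT isT); move: szp k_ge2; clear; lia.
have edge_shape f : f \in F -> exists2 z, z \in U :\: S & inc f = z |: S.
  move=> fF; have [fU cf] := FD f fF.
  have /card_gt0P[z zf] : 0 < #|inc f :\: S|.
    have := subset_leq_card (subsetIr (inc f) S); rewrite cardsD cf cS.
    by move: k_ge2 k_le_r; clear; lia.
  exists z; first exact: (subsetP (setSD _ fU)).
  have zS : z \notin S by move: zf; rewrite inE => /andP[].
  apply/eqP; rewrite eqEcard cardsU1 zS cS cf; apply/andP; split; last by move: k_ge2 k_le_r; clear; lia.
  apply/subsetP=> x xf; rewrite !inE orbC; case: (boolP (x \in S)) => //= xS.
  by apply/eqP/(one_out f); rewrite // inE xS.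
have [f fF] : exists f, f \in F by apply/card_gt0P; rewrite cF; move: k_ge2; clear; lia.
have [x0 x0S] : exists x, x \in S by apply/card_gt0P; rewrite cS; move: k_ge2 k_le_r; clear; lia.
have [z zU def_f] := edge_shape f fF.
have -> : U = S :|: (U :\: S) by rewrite -{1}(setID U S) (setIidPr sS).
have -> : D = F :|: (D :\: F) by rewrite -{1}(setID D F) (setIidPr sF).
apply: (btree_add bt zU _ cS _ cF) => //; rewrite 1?disjoint_sym ?disjoints_subset ?setDE ?subsetIr //.
move=> g gF; have [y yU def_g] := edge_shape g gF; rewrite def_g.
have [->//|zy] := eqVneq z y.
(* Different attachment vertices z and y would give the cycle g, x0, f, z, ..., y, with at least k +
   1 hyperedges. *)
have [p [zp lastp up /allP dp szp]] := bt_path z y zU yU zy.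
have fg : f != g.
  apply: contraNneq zy => fg; rewrite fg def_g in def_f.
  have : z \in y |: S by rewrite def_f !inE eqxx.
  by move: zU; rewrite !inE => /andP[/negPf-> _]; rewrite orbF.
have out_p h : h \in F -> inr h \notin inl z :: p by move=> hF; apply: contra (F_out h hF) => /dp.
have x0p : inl x0 \notin inl z :: p by apply: contraL x0S => /dp; rewrite /= inE => /andP[].
have uq : uniq [:: inr g, inl x0, inr f, inl z & p].
  apply/and4P; split=> //; last exact: out_p.
  - rewrite inE negb_or inE negb_or out_p // andbT.
    by apply: contraNneq fg => -[->].
have := @no_long _ _ uq; rewrite /= rcons_path lastp /= def_f def_g !inE !eqxx x0S !orbT zp /=.
by move=> /(_ isT); move: szp k_ge2; clear; lia.
Qed.

End Extremal.

(** * Berge cycles and connectivity *)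

(** Nodes alternate along the cycle, so its length is even; once it starts at a vertex, even
    positions give the vertices and odd positions the hyperedges. *)
Lemma cycle_berge r (H : multigraph r) k s : 1 < k ->
  cycle (inc_adj (@verts_of r H)) s -> uniq s -> k.*2 <= size s ->
  contains_BC_geq k H.
Proof.
move=> k_ge2; wlog [x0 [p ->]] : s / exists x0 p, s = inl x0 :: p.
  move=> wlog_s; case: s => [|[x|e] p]; first by move: k_ge2; clear => /=; lia.
    by apply: wlog_s; exists x, p.
  rewrite -(rot_cycle 1) -(rot_uniq 1) -(size_rot 1) rot1_cons => cs us szs.
  apply: (wlog_s _ _ cs us szs); move: cs szs.
  case: p {us} => [|[x|f] p] //=; first by exists x, (rcons p (inr e)).
  by rewrite rcons_path last_rcons andbF.
set c := inl x0 :: p => cc uc szc; set d := inl x0 : vertices H + hyperedges H.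
have nth_last_c : nth d (rcons c d) (size c) = inl x0 by rewrite nth_rcons ltnn eqxx.
have alt i : i <= size c -> is_vertex (nth d (rcons c d) i) = ~~ odd i.
  by move=> ic; rewrite (path_alt cc) // size_rcons.
have even_c : odd (size c) = false.
  by have := alt _ (leqnn _); rewrite nth_last_c; case: odd.
have [x1 [e0 [p' def_p]]] : exists x1 e0 p', c = [:: inl x1, inr e0 & p'].
  move: szc cc; rewrite /c; case: (p) => [|[y|e0] p'] //=.
  by move=> *; exists x0, e0, p'.
pose t := (size c)./2; have size_c : size c = t.*2.
  by rewrite -[LHS]odd_double_half even_c.
pose v (i : 'I_t) := if nth d c i.*2 is inl x then x else x0.
pose e (i : 'I_t) := if nth d c i.*2.+1 is inr f then f else e0.
have lt2 (i : 'I_t) : i.*2.+1 < size c by rewrite size_c ltn_Sdouble.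
have nth_c i : i < size c -> nth d (rcons c d) i = nth d c i by move=> ic; rewrite nth_rcons ic.
have def_v (i : 'I_t) : nth d c i.*2 = inl (v i).
  have := alt _ (ltnW (ltnW (lt2 i))); rewrite nth_c ?(ltnW (lt2 i)) // odd_double /v.
  by case: nth.
have def_e (i : 'I_t) : nth d c i.*2.+1 = inr (e i).
  have := alt _ (ltnW (lt2 i)); rewrite nth_c // oddS odd_double /e.
  by case: nth.
have adj_c i : i < size c -> inc_adj (@verts_of r H) (nth d c i) (nth d (rcons c d) i.+1).
  move=> ic; have := pathP d cc i; rewrite size_rcons => /(_ ic).
  by rewrite -nth_c // -rcons_cons.
exists t; first by move: szc; rewrite size_c leq_double.
exists v, e; split.
- move=> i j vij; apply/val_inj/double_inj/eqP.
  by rewrite -(nth_uniq d _ _ uc) ?(ltnW (lt2 _)) // !def_v vij.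
- move=> i j eij; apply/val_inj/double_inj/succn_inj/eqP.
  by rewrite -(nth_uniq d (lt2 i) (lt2 j) uc) !def_e eij.
- move=> i; split.
    by have := adj_c _ (ltnW (lt2 i)); rewrite nth_c // def_v def_e.
  have := adj_c _ (lt2 i); rewrite def_e.
  have [it|it] := ltnP i.+1 t.
    rewrite nth_c -doubleS; last by rewrite size_c ltn_double.
    have -> : (i.+1).*2 = (ordS i).*2 by rewrite /= modn_small.
    by rewrite def_v.
  (* The last hyperedge returns to the first vertex, which [rcons c d] repeats at position
     [size c]. *)
  have eq_t : i.+1 = t by apply/eqP; rewrite eqn_leq it ltn_ord.
  rewrite -doubleS eq_t -size_c nth_last_c -[inl x0]/(nth d c 0).
  have -> : 0 = (ordS i).*2 by rewrite /= eq_t modnn.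
  by rewrite def_v.
Qed.

Section Connectivity.
Variables (T : finType).
Implicit Types (adj : rel T) (S B : {set T}).

Local Notation restr adj S := [rel u w | [&& u \in S, w \in S & adj u w]].

Lemma restr_connect_sym adj S : symmetric adj -> connect_sym (restr adj S).
Proof. by move=> sym; apply: sym_connect_sym => u w /=; rewrite sym andbCA. Qed.

Lemma connected_on_from adj S x0 : symmetric adj -> x0 \in S ->
  (forall y, y \in S -> connect (restr adj S) x0 y) -> connected_on adj S.
Proof.
move=> sym x0S con; apply/andP; split; first by apply/set0Pn; exists x0.
apply/forall_inP=> x xS; apply/forall_inP=> y yS.
by apply: connect_trans (con y yS); rewrite restr_connect_sym ?con.
Qed.

Lemma connected_on_sub adj adj' S : {in S &, subrel adj adj'} ->
  connected_on adj S -> connected_on adj' S.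
Proof.
move=> sub /andP[S0 /forall_inP con]; apply/andP; split=> //.
apply/forall_inP=> x xS; apply/forall_inP=> y yS.
apply: connect_sub (forall_inP (con x xS) y yS) => u w /and3P[uS wS uw].
by apply: connect1; rewrite /= uS wS sub.
Qed.

Lemma nonseparable_sub adj adj' S : {in S &, subrel adj adj'} ->
  nonseparable adj S -> nonseparable adj' S.
Proof.
move=> sub /and3P[S1 conS /forall_inP conSx]; apply/and3P; split=> //.
  exact: connected_on_sub conS.
apply/forall_inP=> x xS; apply: connected_on_sub (conSx x xS).
by move=> u w /setD1P[_ uS] /setD1P[_ wS]; apply: sub.
Qed.

(** Used below to show that a connected set cannot leave [P] when no edge inside it does. *)
Lemma connected_on_closed adj S (P : {set T}) x y : symmetric adj ->
  connected_on adj S -> x \in S -> y \in S -> x \in P ->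
  (forall u w, u \in S -> w \in S -> adj u w -> u \in P -> w \in P) -> y \in P.
Proof.
move=> sym /andP[_ /forall_inP con] xS yS xP closedP.
have := forall_inP (con x xS) y yS; move/closed_connect => /(_ (mem P)) <- //.
apply: (intro_closed (restr_connect_sym S sym)) => u w /and3P[uS wS uw].
exact: closedP uw.
Qed.

Lemma nonseparableD1 adj S x : nonseparable adj S -> connected_on adj (S :\ x).
Proof.
case/and3P=> _ conS /forall_inP conSx; have [/conSx//|xS] := boolP (x \in S).
by rewrite (setDidPl _) // disjoint_sym disjoints1.
Qed.

Lemma clique_nonseparable adj S : symmetric adj -> 1 < #|S| ->
  (forall x y, x \in S -> y \in S -> x != y -> adj x y) -> nonseparable adj S.
Proof.
move=> sym S1 clique.
have con (R : {set T}) : R \subset S -> 0 < #|R| -> connected_on adj R.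
  move=> /subsetP RS /card_gt0P[x0 x0R]; apply: (connected_on_from sym x0R) => y yR.
  have [<-|xy] := eqVneq x0 y; first exact: connect0.
  by apply: connect1; rewrite /= x0R yR clique ?RS.
apply/and3P; split=> //; first by rewrite con // ltnW.
apply/forall_inP=> x xS; apply: con; first exact: subD1set.
by move: S1; rewrite (cardsD1 x) xS ltnS.
Qed.

End Connectivity.

(** * Blocks of the shadow *)

Section SubShadow.
Variables (V E : finType) (inc : E -> {set V}) (k r : nat).
Hypotheses (k_ge2 : 1 < k) (k_le_r : k <= r).
Implicit Types (U S Z B : {set V}) (D F : {set E}).

(** The shadow of the hyperedges in [D] alone, which permits induction along [btree]. *)
Definition sub_shadow D : rel V :=
  fun x y => (x != y) && [exists e in D, (x \in inc e) && (y \in inc e)].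

Lemma sub_shadow_sym D : symmetric (sub_shadow D).
Proof. by move=> x y; rewrite /sub_shadow eq_sym; congr andb; apply: eq_existsb => e; rewrite [X in _ && X]andbC. Qed.

Lemma sub_shadow_mono D D' : D \subset D' -> subrel (sub_shadow D) (sub_shadow D').
Proof.
move=> /subsetP sD x y /andP[xy /exists_inP[e eD xye]].
by rewrite /sub_shadow xy; apply/exists_inP; exists e; rewrite ?sD.
Qed.

Lemma edge_nonseparable D e : e \in D -> 1 < #|inc e| -> nonseparable (sub_shadow D) (inc e).
Proof.
move=> eD e1; apply: clique_nonseparable => // [|x y xe ye xy]; first exact: sub_shadow_sym.
by rewrite /sub_shadow xy; apply/exists_inP; exists e; rewrite ?xe.
Qed.

Lemma btree_spans U D : btree inc k r U D -> spans inc r U D.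
Proof.
elim=> [z|{}U {}D z S F _ IH zU dSU cS _ _ incF] e; first by rewrite inE.
rewrite inE => /orP[/incF->|/IH[eU ->]]; last first.
  by split=> //; apply: subset_trans eU (subsetUr _ _).
have zS : z \notin S by apply: contraL zU => zS; rewrite (disjointFr dSU).
split; first by rewrite subUset subsetUl sub1set inE zU orbT.
by rewrite cardsU1 zS cS; move: k_ge2 k_le_r; clear; lia.
Qed.

Lemma btree_connected U D : btree inc k r U D -> connected_on (sub_shadow D) U.
Proof.
elim=> [z|{}U {}D z S F _ IH zU dSU cS _ cF incF].
  apply: (@connected_on_from _ _ _ z); first exact: sub_shadow_sym.
    by rewrite inE.
  by move=> y /set1P->; apply: connect0.
have [f fF] : exists f, f \in F by apply/card_gt0P; rewrite cF; move: k_ge2; clear; lia.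
have zU' : z \in S :|: U by rewrite inE zU orbT.
apply: (@connected_on_from _ _ _ z) => //; first exact: sub_shadow_sym.
move=> y; rewrite inE => /orP[yS|yU].
  have [<-|zy] := eqVneq z y; first exact: connect0.
  apply: connect1; rewrite /= zU' inE yS /sub_shadow zy; apply/exists_inP; exists f.
    by rewrite inE fF.
  by rewrite incF // !inE eqxx yS orbT.
have /andP[_ /forall_inP con] := IH.
apply: connect_sub (forall_inP (con z zU) y yU) => u w /and3P[uU wU uw].
apply: connect1; rewrite /= !inE uU wU !orbT.
exact: sub_shadow_mono (subsetUr _ _) _ _ uw.
Qed.

(** The vertex [z] separates [S] from the rest of [U]: a hyperedge meeting [S] has no vertex outside
    [S] but [z]. As [B] without [z] is connected, it stays in [S]. *)
Lemma nonseparable_pendant U D z S F B : spans inc r U D -> z \in U ->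
  [disjoint S & U] -> (forall f, f \in F -> inc f = z |: S) ->
  nonseparable (sub_shadow (F :|: D)) B -> ~~ [disjoint B & S] -> B \subset z |: S.
Proof.
move=> UD zU dSU incF nsB /pred0Pn[x /andP[xB xS]].
have neqz u : u \in S -> u != z by move=> uS; apply: contraTneq uS => ->; rewrite (disjointFl dSU).
apply/subsetP=> y yB; rewrite !inE; case: eqVneq => //= yz.
apply: (connected_on_closed (sub_shadow_sym _) (nonseparableD1 z nsB) _ _ xS).
- by rewrite !inE neqz.
- by rewrite !inE yz.
move=> u w /setD1P[_ _] /setD1P[wz _] /andP[_ /exists_inP[e eFD /andP[ue we]]] uS.
move: eFD; rewrite inE => /orP[/incF def_e|/UD[/subsetP eU _]].
  by move: we; rewrite def_e !inE (negPf wz).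
by have := eU u ue; rewrite (disjointFr dSU).
Qed.

(** A block avoiding [S] is a block of the old tree, since a new hyperedge meets it at most in [z].
    A block meeting [S] is [z |: S] by maximality, and an old hyperedge meets that set at most in
    [z]. *)
Lemma btree_blocks U D B : btree inc k r U D -> is_block (sub_shadow D) B ->
  #|B| = r /\ #|[set e in D | inc e \subset B]| = k.-1.
Proof.
move=> bt; elim: bt B => [z|{}U {}D z S F bt IH zU dSU cS dFD cF incF] B /maxsetP[nsB maxB].
  have /and3P[/card_gt1P[x [y [xB yB xy]]] con _] := nsB.
  case/negP: xy; rewrite eq_sym -in_set1.
  apply: (connected_on_closed (sub_shadow_sym _) con xB yB); first by rewrite inE.
  by move=> u w _ _ /andP[_ /exists_inP[e]]; rewrite in_set0.
have UD := btree_spans bt.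
have zS : z \notin S by apply: contraL zU => zS; rewrite (disjointFr dSU).
have cZ : #|z |: S| = r by rewrite cardsU1 zS cS; move: k_ge2 k_le_r; clear; lia.
have [f fF] : exists f, f \in F by apply/card_gt0P; rewrite cF; move: k_ge2; clear; lia.
have [x0 x0S] : exists x, x \in S by apply/card_gt0P; rewrite cS; move: k_ge2 k_le_r; clear; lia.
have [dBS|meetBS] := boolP [disjoint B & S].
  have nsB' : nonseparable (sub_shadow D) B.
    apply: nonseparable_sub nsB => u w uB wB /andP[uw /exists_inP[e eFD /andP[ue we]]].
    rewrite /sub_shadow uw; apply/exists_inP; exists e; rewrite ?ue //.
    move: eFD; rewrite inE => /orP[/incF def_e|//].
    move: ue we uw; rewrite def_e !inE (disjointFr dBS uB) (disjointFr dBS wB) !orbF.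
    by move=> /eqP-> /eqP->; rewrite eqxx.
  have [|cB cD] := IH B.
    apply/maxsetP; split=> // C nsC sBC; apply: maxB => //.
    by apply: nonseparable_sub nsC => u w _ _; apply: sub_shadow_mono; apply: subsetUr.
  split=> //; rewrite -cD; apply: eq_card => e; rewrite !inE.
  case: (boolP (e \in F)) => //= eF; rewrite (disjointFr dFD eF) /= incF //.
  by apply/negP=> /subsetP/(_ x0); rewrite !inE x0S orbT => /(_ isT) x0B; rewrite (disjointFr dBS x0B) in x0S.
have BZ := nonseparable_pendant UD zU dSU incF nsB meetBS.
have nsZ : nonseparable (sub_shadow (F :|: D)) (z |: S).
  by rewrite -(incF f fF); apply: edge_nonseparable; rewrite ?inE ?fF // incF // cZ (leq_trans k_ge2).
rewrite -(maxB _ nsZ BZ) cZ; split=> //; rewrite -cF; apply: eq_card => e; rewrite !inE.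
case: (boolP (e \in F)) => [eF|_] /=; first by rewrite incF // subxx.
apply/negP=> /andP[/UD[/subsetP eU ce] /subsetP eZ].
have : #|inc e| <= #|[set z]|.
  apply/subset_leq_card/subsetP=> x xe; have := eZ x xe; rewrite !inE.
  by case: (eqVneq x z) => //= _ xS; have := eU x xe; rewrite (disjointFr dSU).
by rewrite cards1 ce; move: k_ge2 k_le_r; clear; lia.
Qed.

End SubShadow.

(** * Block trees are extremal *)

(** Induction once around the cycle that never steps back into [i0], so nothing need hold at the
    passage through [i0]. *)
Lemma ord_cycle_ind t (P : 'I_t -> Prop) i0 : P i0 ->
  (forall i, P i -> ordS i != i0 -> P (ordS i)) -> forall i, P i.
Proof.
move=> P0 PS.
have val_iter m : iter m (@ordS t) i0 = (i0 + m) %% t :> nat.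
  elim: m => [|m IH]; first by rewrite addn0 modn_small.
  by rewrite iterS /= IH -addn1 modnDml addn1 addnS.
have P_iter m : m < t -> P (iter m (@ordS t) i0).
  elim: m => // m IH mt; apply: PS; first exact/IH/ltnW.
  rewrite -iterS -val_eqE [val (iter _ _ _)]val_iter -[X in _ != X](modn_small (ltn_ord i0)).
  by rewrite -[X in _ != X %% t]addn0 eqn_modDl mod0n modn_small.
move=> i; have i0t := ltn_ord i0; have it := ltn_ord i.
suff -> : i = iter ((i + t - i0) %% t) (@ordS t) i0 by apply/P_iter/ltn_pmod/(leq_ltn_trans _ it).
apply: val_inj; rewrite [RHS]val_iter modnDmr subnKC; last by rewrite (leq_trans (ltnW i0t)) ?leq_addl.
by rewrite modnDr modn_small.
Qed.

Section BlockTree.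
Variables (r k : nat) (H : multigraph r).
Hypotheses (k_ge2 : 1 < k) (k_le_r : k <= r).
Local Notation adj := (@shadow r H).
Implicit Types (e f : hyperedges H) (W X Y : {set vertices H}).

Lemma shadow_sym : symmetric adj.
Proof. by move=> x y; rewrite /shadow eq_sym; congr andb; apply: eq_existsb => e; rewrite andbC. Qed.

Lemma shadow_edge e x y : x \in verts_of e -> y \in verts_of e -> x != y -> adj x y.
Proof. by move=> xe ye xy; rewrite /shadow xy; apply/existsP; exists e; rewrite xe. Qed.

(** Consecutive hyperedges share a vertex of the cycle. Deleting a set [X] of at most one vertex
    destroys at most one of these links, and the rest of the cycle still connects everything. Empty
    [X] gives connectedness, singletons give the absence of cut vertices. *)
Lemma berge_cycle_nonseparable t (v : 'I_t -> vertices H) (e : 'I_t -> hyperedges H) :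
  1 < t -> injective v ->
  (forall i, v i \in verts_of (e i) /\ v (ordS i) \in verts_of (e i)) ->
  nonseparable adj (\bigcup_i verts_of (e i)).
Proof.
move=> t1 inj_v ve; set W := \bigcup_i _.
have sub_W i x : x \in verts_of (e i) -> x \in W by move=> xe; apply/bigcupP; exists i.
have con X : #|X| <= 1 -> connected_on adj (W :\: X).
  move=> X1.
  have [i0 i0X] : exists i0, forall i, i != i0 -> v i \notin X.
    case: (pickP [pred i | v i \in X]) => [i0 i0X|noX]; last first.
      by exists (Ordinal (ltnW t1)) => i _; have /= -> := noX i.
    exists i0 => i; apply: contra_neqN => iX; apply: inj_v.
    by apply: (card_le1_eqP X1).
  have i1 : ordS i0 != i0.
    rewrite -val_eqE /=; have := ltn_ord i0; rewrite leq_eqVlt => /orP[/eqP eq_t|lt_t].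
      by rewrite eq_t modnn; move: eq_t t1; case: (val i0) => [<-|].
    by rewrite modn_small // neq_ltn leqnn orbT.
  have [_ v1e] := ve i0; have v1X := i0X _ i1.
  have step (i : 'I_t) x y : x \in verts_of (e i) :\: X -> y \in verts_of (e i) :\: X ->
      connect [rel u w | [&& u \in W :\: X, w \in W :\: X & adj u w]] x y.
    have [<- _ _|xy] := eqVneq x y; first exact: connect0.
    rewrite 2!inE => /andP[xX xe] /andP[yX ye]; apply: connect1.
    by rewrite /= !inE xX yX !(sub_W i) //= (shadow_edge xe ye).
  apply: (@connected_on_from _ _ _ (v (ordS i0)) shadow_sym); first by rewrite inE v1X (sub_W i0).
  suff all_con i y : y \in verts_of (e i) :\: X ->
      connect [rel u w | [&& u \in W :\: X, w \in W :\: X & adj u w]] (v (ordS i0)) y.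
    by move=> y; rewrite inE => /andP[yX /bigcupP[i _ ye]]; apply: (all_con i); rewrite inE yX.
  move: y; move: i; apply: (ord_cycle_ind (i0 := i0)) => [|i IH iS] y ye.
    by apply: step ye; rewrite inE v1X.
  have [vS1 _] := ve (ordS i); have [_ vS2] := ve i; have vSX := i0X _ iS.
  have vS1' : v (ordS i) \in verts_of (e (ordS i)) :\: X by rewrite in_setD vSX.
  have vS2' : v (ordS i) \in verts_of (e i) :\: X by rewrite in_setD vSX.
  exact: connect_trans (IH _ vS2') (step _ _ _ vS1' ye).
apply/and3P; split.
- have i0 := Ordinal (ltnW t1); apply: leq_trans (leq_trans k_ge2 k_le_r) _.
  have /subset_leq_card : verts_of (e i0) \subset W by apply/subsetP/sub_W.
  by rewrite card_verts_of.
- by have := con set0; rewrite cards0 setD0; apply.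
- by apply/forall_inP=> x _; apply: con; rewrite cards1.
Qed.

Hypothesis bt : block_tree (k - 1) H.

(** A hyperedge is a clique of r vertices, so the block containing it is the hyperedge itself. *)
Lemma card_copies e : #|[set f | verts_of f \subset verts_of e]| = k - 1.
Proof.
have ns : nonseparable adj (verts_of e).
  apply: clique_nonseparable; [exact: shadow_sym | by rewrite card_verts_of (leq_trans k_ge2) | exact: shadow_edge].
have [B maxB sub_eB] := maxset_exists ns; have [cB cE] := bt.2 B maxB.
suff -> : verts_of e = B by [].
by apply/eqP; rewrite eqEcard sub_eB cB card_verts_of leqnn.
Qed.

(** All hyperedges of a Berge cycle lie in one block, which has only k - 1 of them. *)
Lemma block_tree_no_BC : ~ contains_BC_geq k H.
Proof.
move=> [t kt [v [e [inj_v inj_e ve]]]].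
have [B maxB /subsetP sub_B] := maxset_exists (berge_cycle_nonseparable (leq_trans k_ge2 kt) inj_v ve).
have [_ cB] := bt.2 B maxB.
have : #|[set e i | i in 'I_t]| <= k - 1.
  rewrite -cB; apply/subset_leq_card/subsetP=> _ /imsetP[i _ ->]; rewrite inE.
  by apply/subsetP=> x xe; apply: sub_B; apply/bigcupP; exists i.
by rewrite card_imset // card_ord; move: k_ge2 kt; clear; lia.
Qed.

(** While [Y] is not everything, connectedness gives a hyperedge that meets [Y] and leaves it.
    Adding it brings at most r - 1 new vertices and exactly k - 1 new hyperedges, its copies, which
    preserves the inequality. *)
Lemma block_tree_grow Y (D : {set hyperedges H}) : Y != set0 ->
  (forall e, e \in D -> verts_of e \subset Y) ->
  #|Y|.-1 * (k - 1) <= #|D| * r.-1 ->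
  #|vertices H|.-1 * (k - 1) <= #|hyperedges H| * r.-1.
Proof.
have [n] := ubnP #|~: Y|; elim: n Y D => // n IH Y D le_n /set0Pn[u0 u0Y] DY cY.
have [YT|YT] := eqVneq Y setT.
  rewrite YT cardsT in cY; apply: leq_trans cY _.
  by rewrite leq_mul2r max_card orbT.
have [w0 w0Y] : exists w, w \notin Y.
  by apply/existsP; rewrite -negb_forall; apply: contraNN YT => /forallP YT; apply/eqP/setP=> x; rewrite inE YT.
have [u [w [uY wY uw]]] : exists u w, [/\ u \in Y, w \notin Y & adj u w].
  have [/existsP[u /existsP[w /and3P[]]]|no_uw] := boolP [exists u, exists w, [&& u \in Y, w \notin Y & adj u w]].
    by exists u, w.
  case/negP: w0Y; apply: (connected_on_closed shadow_sym bt.1 (in_setT u0) (in_setT w0) u0Y).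
  move=> x y _ _ xy xY; apply: contraNT no_uw => yY.
  by apply/existsP; exists x; apply/existsP; exists y; rewrite xY yY.
have /andP[_ /existsP[e /andP[ue we]]] := uw.
pose F := [set f | verts_of f \subset verts_of e].
have FE f : f \in F -> verts_of f = verts_of e.
  by rewrite inE => fe; apply/eqP; rewrite eqEcard fe !card_verts_of leqnn.
have dFD : [disjoint F & D].
  apply/pred0P=> f; apply/negP=> /andP[fF fD]; case/negP: wY.
  by apply: (subsetP (DY f fD)); rewrite (FE f fF).
apply: (IH (verts_of e :|: Y) (F :|: D)).
- have : #|~: (verts_of e :|: Y)| < #|~: Y|; last by move: le_n; clear; lia.
  apply: proper_card; rewrite properE setCS subsetUr; apply/subsetPn; exists w; rewrite !inE ?we //.
- by apply/set0Pn; exists u0; rewrite inE u0Y orbT.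
- move=> f; rewrite inE => /orP[/FE->|/DY fY]; first exact: subsetUl.
  exact: subset_trans fY (subsetUr _ _).
have : #|verts_of e :|: Y| < #|Y| + r.
  rewrite cardsU card_verts_of; have : 0 < #|verts_of e :&: Y| by apply/card_gt0P; exists u; rewrite inE ue.
  have := subset_leq_card (subsetIl (verts_of e) Y); rewrite card_verts_of; clear; lia.
have -> : #|F :|: D| = (k - 1) + #|D|.
  by rewrite cardsU (disjoint_setI0 dFD) cards0 subn0 card_copies.
have : 0 < #|Y| by apply/card_gt0P; exists u0.
move: cY; clear; rewrite mulnDl => cY Y0 lt.
apply: leq_trans (_ : (#|Y|.-1 + r.-1) * (k - 1) <= _); first by rewrite leq_mul2r; apply/orP; right; lia.
by rewrite mulnDl addnC [r.-1 * _]mulnC leq_add2l.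
Qed.

Lemma block_tree_card_ge : 0 < #|vertices H| ->
  #|vertices H|.-1 * (k - 1) <= #|hyperedges H| * r.-1.
Proof.
case/card_gt0P=> x _; apply: (@block_tree_grow [set x] set0).
- by apply/set0Pn; exists x; rewrite inE.
- by move=> e; rewrite inE.
- by rewrite cards1.
Qed.

End BlockTree.

(** * The star construction *)

Section Star.
Variables (n q m r : nat).
Hypotheses (r_gt1 : 1 < r) (q_le : q * r.-1 <= n).

(** The first component of [p] selects one of q blocks that share only the centre 0, the second one
    of its m copies. Leftover vertices are isolated. *)
Definition star_leaf (p : 'I_q * 'I_m) (l : 'I_r.-1) : 'I_n.+1 :=
  inord (p.1 * r.-1 + l).+1.

Definition star_verts (p : 'I_q * 'I_m) : {set 'I_n.+1} :=
  ord0 |: [set star_leaf p l | l in 'I_r.-1].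

Lemma val_star_leaf p l : star_leaf p l = (p.1 * r.-1 + l).+1 :> nat.
Proof.
rewrite inordK // ltnS; apply: leq_trans q_le; apply: leq_trans (_ : (p.1).+1 * r.-1 <= _).
  by rewrite mulSnr ltn_add2l.
by rewrite leq_mul2r ltn_ord orbT.
Qed.

Lemma card_star_verts p : #|star_verts p| = r.
Proof.
rewrite cardsU1 card_imset ?card_ord; last first.
  by move=> l l' /(congr1 (@nat_of_ord _)); rewrite !val_star_leaf => -[/addnI/val_inj].
rewrite (_ : ord0 \notin _) ?add1n ?prednK ?(ltnW r_gt1) //.
by apply/imsetP=> -[l _ /(congr1 (@nat_of_ord _))]; rewrite val_star_leaf.
Qed.

Definition star : multigraph r := Multigraph card_star_verts.

(** Consecutive hyperedges share a vertex that, with at most one exception, is not the centre and so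
    determines the block. Hence the whole cycle uses copies of a single hyperedge, of which there
    are m. *)
Lemma star_no_BC : ~ contains_BC_geq m.+1 star.
Proof.
case=> t mt [v [e [inj_v inj_e ve]]].
have t0 : 0 < t := leq_ltn_trans (leq0n m) mt.
have [i0 i0P] : exists i0, forall i, i != i0 -> v i != ord0.
  case: (pickP [pred i | v i == ord0]) => [i0 /eqP i00|no0]; last first.
    by exists (Ordinal t0) => i _; have /= -> := no0 i.
  by exists i0 => i; apply: contra_neq; rewrite -i00; apply: inj_v.
have block (x : 'I_n.+1) (p : 'I_q * 'I_m) : x \in star_verts p -> x != ord0 -> p.1 = x.-1 %/ r.-1 :> nat.
  rewrite !inE => /orP[->//|/imsetP[l _ ->]] _; rewrite val_star_leaf /=.
  have r1 : 0 < r.-1 by move: r_gt1; clear; lia.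
  by rewrite divnMDl // divn_small ?addn0.
have same i : (e i).1 = (e i0).1.
  move: i; apply: (ord_cycle_ind (i0 := i0)) => // i <- iS.
  have [[_ v1] [v2 _]] := (ve i, ve (ordS i)); have vS := i0P _ iS.
  by apply: val_inj; rewrite /= (block _ _ v1 vS) (block _ _ v2 vS).
have inj2 : injective (fun i => (e i).2).
  by move=> i j eq2; apply: inj_e; rewrite [LHS]surjective_pairing [RHS]surjective_pairing !same eq2.
by have := leq_card _ inj2; rewrite !card_ord leqNgt mt.
Qed.

End Star.

(** * From incidence graphs back to multigraphs, and the final count *)

Lemma no_BC_no_long r (H : multigraph r) k s : 1 < k -> ~ contains_BC_geq k H ->
  cycle (inc_adj (@verts_of r H)) s -> uniq s -> size s < k.*2.
Proof. by move=> k1 noBC cs us; rewrite ltnNge; apply/negP=> ks; apply/noBC/(cycle_berge k1 cs us ks). Qed.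

Lemma spansT r (H : multigraph r) : spans (@verts_of r H) r setT setT.
Proof. by move=> e _; rewrite subsetT card_verts_of. Qed.

Lemma no_BC_card_le r k (H : multigraph r) : 1 < k -> k <= r ->
  ~ contains_BC_geq k H ->
  #|hyperedges H| <= (#|vertices H| - 1) %/ (r - 1) * (k - 1).
Proof.
move=> k1 kr noBC; have no_long s := @no_BC_no_long r H k s k1 noBC.
by have := card_edges_le k1 kr no_long (@spansT r H); rewrite !cardsT !subn1.
Qed.

Lemma btree_block_tree r k (H : multigraph r) : 1 < k -> k <= r ->
  btree (@verts_of r H) k r setT setT -> block_tree (k - 1) H.
Proof.
move=> k1 kr bt.
have eq_sh x y : sub_shadow (@verts_of r H) setT x y = shadow x y.
  by rewrite /sub_shadow /shadow; congr andb; apply: eq_existsb => e; rewrite inE.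
split; first by apply: connected_on_sub (btree_connected k1 bt) => x y _ _; rewrite eq_sh.
move=> B /maxsetP[nsB maxB]; have [|cB cE] := btree_blocks k1 kr bt (B := B).
  apply/maxsetP; split=> [|C nsC sBC].
    by apply: nonseparable_sub nsB => x y _ _; rewrite eq_sh.
  by apply: maxB => //; apply: nonseparable_sub nsC => x y _ _; rewrite eq_sh.
split=> //; rewrite subn1 -cE; apply: eq_card => e; rewrite !inE.
by [].
Qed.

Theorem theorem12 (k n r : nat) (k_gt0 : 0 < k) (n_gt0 : 0 < n) (r_gt0 : 0 < r)
    (k_ge2 : 2 <= k) (k_le_r : k <= r) :
  is_ex_multi n (@contains_BC_geq r k) ((n - 1) %/ (r - 1) * (k - 1)) /\
  ((r - 1) %| (n - 1) ->
   forall H : multigraph r, #|vertices H| = n ->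
     (extremal n (@contains_BC_geq r k) H <-> block_tree (k - 1) H)).
Proof.
have r_gt1 : 1 < r := leq_trans k_ge2 k_le_r.
have ub (H : multigraph r) : #|vertices H| = n -> ~ contains_BC_geq k H ->
    #|hyperedges H| <= (n - 1) %/ (r - 1) * (k - 1).
  by move=> <-; apply: no_BC_card_le.
(* The star with as many blocks as fit on the n - 1 vertices other than the centre attains the
   bound. *)
have [H0 [cV0 noBC0 cE0]] : exists H0 : multigraph r, [/\ #|vertices H0| = n,
    ~ contains_BC_geq k H0 & #|hyperedges H0| = (n - 1) %/ (r - 1) * (k - 1)].
  have q_le : (n - 1) %/ (r - 1) * r.-1 <= n - 1 by rewrite -subn1 leq_divM.
  exists (@star (n - 1) _ (k - 1) r r_gt1 q_le); split.
  - by rewrite card_ord subn1 prednK.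
  - by have := @star_no_BC (n - 1) _ (k - 1) r r_gt1 q_le; rewrite subn1 prednK.
  - by rewrite card_prod !card_ord.
split.
  by exists H0 => //; split=> // H' cV' noBC'; rewrite cE0 ub.
move=> dvd H cV; split=> [[_ noBC maxH]|bt].
  have cE : #|hyperedges H| = (n - 1) %/ (r - 1) * (k - 1).
    by apply/eqP; rewrite eqn_leq ub //= -cE0 maxH.
  apply: btree_block_tree => //; have no_long s := @no_BC_no_long r H k s k_ge2 noBC.
  apply: (extremal_btree k_ge2 k_le_r no_long (@spansT r H)).
  - by rewrite -card_gt0 cardsT cV.
  - by rewrite cardsT cV -!subn1.
  - by rewrite !cardsT cV cE !subn1.
have noBC := block_tree_no_BC k_ge2 k_le_r bt; split=> // H' cV' noBC'.
(* By divisibility, the lower bound for block trees equals the upper bound after cancelling r -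
   1. *)
apply: leq_trans (ub _ cV' noBC') _.
have := block_tree_card_ge k_ge2 k_le_r bt; rewrite cV => /(_ n_gt0).
by rewrite -!subn1 -{1}(divnK dvd) mulnAC leq_pmul2r // subn_gt0.
Qed.
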